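(* Let $\pi,\tau\in S_n$ with $d(\pi,\tau)=1$, and let $\lambda=\lambda(\pi)$, $\mu=\lambda(\tau)$. Then \[\Delta(\lambda,\mu)\le\sqrt{n/2}.\]
   Context: Permutations are written in one-line notation. For $\pi\in S_n$, $\lambda(\pi)$ denotes the shape (a partition of $n$) of the tableaux associated with $\pi$ by the RSK correspondence. The distance $d(\pi,\tau)$ is the least number of adjacent transpositions $(k,k+1)$, $1\le k\le n-1$, whose successive left multiplication transforms $\pi$ into $\tau$. For partitions $\lambda,\mu$ of $n$ (parts padded with zeros), $\Delta(\lambda,\mu)=\frac12\sum_{i=1}^n|\lambda_i-\mu_i|$. *)

(* Defs.v *)
From HB Require Import structures.
From mathcomp Require Import all_boot all_order all_algebra all_fingroup.
Set Implicit Arguments. Unset Strict Implicit. Unset Printing Implicit Defensive.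
Import Order.TTheory GRing.Theory Num.Theory.

(* A tableau is a list of rows (top row first), each row an increasing seq nat. *)

Definition bump (x : nat) (r : seq nat) : option (nat * seq nat) :=
  let i := find (fun y => x < y) r in
  if i < size r then Some (nth 0 r i, set_nth 0 r i x) else None.

Fixpoint row_insert (x : nat) (t : seq (seq nat)) : seq (seq nat) :=
  match t with
  | [::] => [:: [:: x]]
  | r :: t' =>
      match bump x r with
      | None => rcons r x :: t'
      | Some (y, r') => r' :: row_insert y t'
      end
  end.

Definition insertion_tableau (w : seq nat) : seq (seq nat) :=
  foldl (fun t x => row_insert x t) [::] w.

(* One-line notation of pi in S_n : the word pi(0) pi(1) ... pi(n-1)
   (0-based values; the order is the same as for 1..n). *)
Definition one_line n (pi : 'S_n) : seq nat := [seq val (pi i) | i <- enum 'I_n].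

Definition rsk_shape n (pi : 'S_n) : seq nat :=
  map size (insertion_tableau (one_line pi)).

(* Left multiplication by the adjacent transposition (k, k+1) (0-based k,
   k+1 < n): the result is  i |-> s_k (pi i), i.e. mathcomp's  pi * s_k
   (since (p * q) i = q (p i)). *)
Definition adj_lmul n (k : 'I_n) (pi : 'S_n) : 'S_n :=
  (pi * tperm k (insubd k k.+1))%g.

Definition reach_in n (m : nat) (pi tau : 'S_n) : Prop :=
  exists ks : seq 'I_n,
    [/\ size ks = m, all (fun k : 'I_n => k.+1 < n) ks &
        tau = foldl (fun p k => adj_lmul k p) pi ks].

Definition perm_dist_is n (d : nat) (pi tau : 'S_n) : Prop :=
  reach_in d pi tau /\ forall m, reach_in m pi tau -> d <= m.

Definition natdist (a b : nat) : nat := (a - b) + (b - a).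

Definition shape_l1 (n : nat) (la mu : seq nat) : nat :=
  \sum_(i < n) natdist (nth 0 la i) (nth 0 mu i).

Definition Delta (R : rcfType) (n : nat) (la mu : seq nat) : R :=
  ((shape_l1 n la mu)%:R / 2%:R)%R.

(* Main.v *)
(* By Greene's theorem, lambda_1 + ... + lambda_k is the largest number of letters of the
   word covered by k disjoint increasing subsequences. Exchanging the values x < x+1, with x
   before x+1, turns an increasing subsequence into a decreasing one only if it uses both
   letters; hence the partial sums of lambda and mu satisfy M_k <= L_k <= M_k + 1. So the
   differences lambda_i - mu_i are 0 or +-1, the nonzero ones alternating in sign; monotonicity
   of lambda and mu then forces every change of sign to cost one more box, whence
   (sum |lambda_i - mu_i|)^2 <= |lambda| + |mu| = 2n. *)
Require Import Defs.
From HB Require Import structures.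
From mathcomp Require Import all_boot all_order all_algebra all_fingroup.
From mathcomp Require Import zify lra.
Set Implicit Arguments. Unset Strict Implicit. Unset Printing Implicit Defensive.

(** * Covering a word by k disjoint increasing subsequences *)

(* Colours below k stand for the k subsequences; any colour >= k marks an unused letter. *)
Definition chain_coloring (k : nat) (c : nat -> nat) (w : seq nat) : bool :=
  pairwise (fun x y => (c x == c y) && (c x < k) ==> (x < y)) w.

Definition covers (k : nat) (w : seq nat) (m : nat) : Prop :=
  exists2 c, chain_coloring k c w & count (fun x => c x < k) w = m.

(** The [perm_eq] clause lets distinctness of letters pass along a chain of equivalences. *)
Definition greene_equiv (u v : seq nat) : Prop :=
  perm_eq u v /\ forall k m, covers k u m <-> covers k v m.

Lemma greene_equiv_refl u : greene_equiv u u.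
Proof. by split. Qed.

Lemma greene_equiv_sym u v : greene_equiv u v -> greene_equiv v u.
Proof.
by case=> p h; split=> [|k m]; [rewrite perm_sym | apply: iff_sym].
Qed.

Lemma greene_equiv_trans v u w :
  greene_equiv u v -> greene_equiv v w -> greene_equiv u w.
Proof.
case=> p h [p' h']; split=> [|k m]; first exact: perm_trans p p'.
by apply: iff_trans (h k m) (h' k m).
Qed.

Lemma chain_coloring_cat k c u v :
  chain_coloring k c (u ++ v) =
  [&& allrel (fun x y => (c x == c y) && (c x < k) ==> (x < y)) u v,
      chain_coloring k c u & chain_coloring k c v].
Proof. exact: pairwise_cat. Qed.

(** Serves the recolourings below: only pairs that the new colouring puts into one subsequence can
    violate it, and these already increase under the old one. *)
Lemma chain_coloring_sub k k' c c' w :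
  {in w &, forall x y, c' x = c' y -> c' x < k' -> c x = c y /\ c x < k} ->
  chain_coloring k c w -> chain_coloring k' c' w.
Proof.
move=> h; apply: (sub_in_pairwise (P := [in w])); last exact/allP.
move=> x y xw yw /implyP r; apply/implyP => /andP[/eqP e l].
by apply: r; have [-> ->] := h _ _ xw yw e l; rewrite eqxx.
Qed.

(** The curried form of the boolean test, so that [chain_solve] can discharge its premises one at a
    time. *)
Definition chain_rel k (c : nat -> nat) x y := c x = c y -> c x < k -> x < y.

Lemma chain_relP k c x y :
  reflect (chain_rel k c x y) ((c x == c y) && (c x < k) ==> (x < y)).
Proof.
apply: (iffP implyP) => [h e l|h /andP[/eqP]]; last exact: h.
by apply: h; rewrite e eqxx -e.
Qed.

Lemma allrel_chainP k c u v :
  reflect {in u & v, forall x y, chain_rel k c x y}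
          (allrel (fun x y => (c x == c y) && (c x < k) ==> (x < y)) u v).
Proof.
apply: (iffP allrelP) => h x y xu yv; last exact/chain_relP/h.
exact/chain_relP/h.
Qed.

Lemma chain_coloring_mid k c s x y z t :
  chain_coloring k c (s ++ [:: x; y; z] ++ t) <->
  [/\ [/\ chain_coloring k c s, chain_coloring k c t
        & {in s & t, forall u v, chain_rel k c u v}],
      {in s, forall u, [/\ chain_rel k c u x, chain_rel k c u y & chain_rel k c u z]},
      {in t, forall v, [/\ chain_rel k c x v, chain_rel k c y v & chain_rel k c z v]}
    & [/\ chain_rel k c x y, chain_rel k c x z & chain_rel k c y z]].
Proof.
rewrite !chain_coloring_cat allrel_catr; split.
  case/and3P=> /andP[/allrel_chainP h1 /allrel_chainP h2] h3.
  case/and3P=> /allrel_chainP h4 h5 h6; split=> //.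
  - by move=> u us; split; apply: h1; rewrite // !inE eqxx ?orbT.
  - by move=> v vt; split; apply: h4; rewrite // !inE eqxx ?orbT.
  - by move: h5; rewrite /= !andbT => /andP[/andP[/chain_relP ? /chain_relP ?] /chain_relP ?].
case=> [[h3 h6 h2] h1 h4 [xy xz yz]]; apply/and3P; split=> //.
  apply/andP; split; last exact/allrel_chainP.
  apply/allrel_chainP => u v us; have [ux uy uz] := h1 u us.
  by rewrite !inE => /or3P[] /eqP->.
apply/and3P; split=> //.
  apply/allrel_chainP => u v us vt; have [ux uy uz] := h4 v vt.
  by move: us; rewrite !inE => /or3P[] /eqP->.
by rewrite /= !andbT; do ![apply/andP; split]; apply/chain_relP.
Qed.

(** * Invariance under the two Knuth relations *)

Definition swap_col (p q z : nat) := if z == p then q else if z == q then p else z.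

(** Only equations, disequations, inequalities and implications are kept. Premises on colours are
    settled by [congruence], an implication whose premise resists is dropped, and the order facts
    that remain go to [lia]. *)
Ltac chain_solve :=
  intros;
  repeat match goal with
  | H : ?P |- _ =>
    lazymatch type of P with Prop =>
      lazymatch P with
      | is_true (leq _ _) => fail
      | _ = _ => fail
      | _ <> _ => fail
      | ?Q -> _ => lazymatch type of Q with Prop => fail | _ => clear H end
      | _ => clear H
      end
    end
  | f := _ : _ -> _ |- _ => clearbody f
  end;
  repeat match goal with
  | H : ?P -> _ |- _ => first [specialize (H ltac:(congruence)) | clear H]
  end; lia.

(** A colouring of the right word also fits the left one: only the pair a, c changes order, and it
    becomes increasing. Conversely, only a subsequence through both a and c is broken, and b, whose
    value lies between theirs, repairs it. *)
Lemma knuth_bac s t a b c : a < b < c -> uniq (s ++ [:: b; a; c] ++ t) ->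
  greene_equiv (s ++ [:: b; a; c] ++ t) (s ++ [:: b; c; a] ++ t).
Proof.
move=> /andP[ab bc] u; split.
  by rewrite perm_cat2l perm_cat2r /= perm_cons (perm_catC [:: a] [:: c]).
have [at_ bt ct] : [/\ a \notin t, b \notin t & c \notin t].
  move: u; rewrite cat_uniq /= !inE !negb_or.
  by case/and3P=> _ _ /and4P[/and3P[_ _ ->] /andP[_ ->] ->].
have [as_ bs cs st] :
    [/\ a \notin s, b \notin s, c \notin s & {in s, forall x, x \notin t}].
  move: u; rewrite cat_uniq => /and3P[_ /hasPn h _].
  split; try by apply: h; rewrite !inE eqxx ?orbT.
  by move=> x xs; apply/negP => xt; have := h x; rewrite mem_cat xt orbT xs => /(_ isT).
move=> k m; split=> -[col]; last first.
  move=> /chain_coloring_mid[h1 h2 h3 [h4 h5 h6]] <-; exists col.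
    apply/chain_coloring_mid; split=> //; last by split=> // _ _; clear -ab bc; lia.
      by move=> x /h2[].
    by move=> x /h3[].
  by rewrite !count_cat /=; clear; lia.
move=> /chain_coloring_mid[[hs ht hst] h2 h3 [h4 h5 h6]] <-.
rewrite /chain_rel in h2 h3 h4 h5 h6 hst.
have [/andP[/eqP e ck]|ne] := boolP ((col a == col c) && (col a < k)); last first.
  exists col; last by rewrite !count_cat /=; clear; lia.
  apply/chain_coloring_mid; rewrite /chain_rel; split=> //.
  - by move=> x /h2[].
  - by move=> x /h3[].
  - by split=> // ee l; move: ne; rewrite -ee eqxx l.
have [bk|bk] := ltnP (col b) k; last first.
  (* The unused b takes the place of a or c in their common subsequence. *)
  pose col' x := if x == b then col a else if x == a then k else col x.
  have es x : x \in s -> col' x = col x.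
    move=> xs; rewrite /col'.
    by do 2![case: eqP => [xx|_];
      first by rewrite xx in xs; rewrite xs in as_ bs].
  have et x : x \in t -> col' x = col x.
    move=> xs; rewrite /col'.
    by do 2![case: eqP => [xx|_];
      first by rewrite xx in xs; rewrite xs in at_ bt].
  have ea : col' a = k by rewrite /col' eqxx; case: eqP => //; clear -ab bc; lia.
  have eb : col' b = col a by rewrite /col' eqxx.
  have ec : col' c = col c by rewrite /col'; do 2![case: eqP; first by clear -ab bc; lia].
  exists col'; last first.
    rewrite !count_cat /= ea eb ec.
    have -> : count (fun x => col' x < k) s = count (fun x => col x < k) s.
      by apply: eq_in_count; move=> x /es ->.
    have -> : count (fun x => col' x < k) t = count (fun x => col x < k) t.
      by apply: eq_in_count; move=> x /et ->.
    by move: bk ck; rewrite -e; clear; lia.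
  apply/chain_coloring_mid; rewrite /chain_rel ea eb ec; split; first split.
  - by apply: chain_coloring_sub hs => x y /es-> /es->.
  - by apply: chain_coloring_sub ht => x y /et-> /et->.
  - by move=> x y xs yt; rewrite (es _ xs) (et _ yt); apply: hst.
  - by move=> x xs; rewrite (es _ xs); have [] := h2 x xs; split; chain_solve.
  - by move=> x xt; rewrite (et _ xt); have [] := h3 x xt; split; chain_solve.
  - by split; chain_solve.
(* P1 a c P2 and Q1 b Q2 exchange their tails, which keeps the same letters covered. *)
pose col' x := if (x == c) || (x \in t) then swap_col (col a) (col b) (col x) else col x.
have es x : x \in s -> col' x = col x.
  move=> xs; rewrite /col' (negbTE (st _ xs)) orbF; case: eqP => // xx.
  by rewrite xx (negbTE cs) in xs.
have et x : x \in t -> col' x = swap_col (col a) (col b) (col x).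
  by move=> xs; rewrite /col' xs orbT.
have ea : col' a = col a by rewrite /col' (negbTE at_); case: eqP => //; clear -ab bc; lia.
have eb : col' b = col b by rewrite /col' (negbTE bt); case: eqP => //; clear -ab bc; lia.
have ec : col' c = col b by rewrite /col' eqxx /swap_col e eqxx.
exists col'; last first.
  rewrite !count_cat /= ea eb ec.
  have -> : count (fun x => col' x < k) s = count (fun x => col x < k) s.
      by apply: eq_in_count; move=> x /es ->.
  have -> : count (fun x => col' x < k) t = count (fun x => col x < k) t.
      by apply: eq_in_count; move=> x /et ->; rewrite /swap_col; do 2?case: eqP; chain_solve.
  by rewrite -e ck bk; clear; lia.
apply/chain_coloring_mid; rewrite /chain_rel ea eb ec; split; first split.
- by apply: chain_coloring_sub hs => x y /es-> /es->.
- apply: chain_coloring_sub ht => x y /et-> /et->.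
  by rewrite /swap_col; do 4?case: eqP; chain_solve.
- move=> x y xs yt; rewrite (es _ xs) (et _ yt).
  have := hst x y xs yt; have [] := h2 x xs; have [] := h3 y yt.
  by rewrite /swap_col; do 2?case: eqP; chain_solve.
- by move=> x xs; rewrite (es _ xs); have [] := h2 x xs; split; chain_solve.
- move=> x xt; rewrite (et _ xt); have [] := h3 x xt.
  by rewrite /swap_col; do 2?case: eqP; split; chain_solve.
- by split; chain_solve.
Qed.

(** As in [knuth_bac], b repairs the subsequence through a and c. Here b follows both letters, so a
    free b replaces c, and otherwise a continues with b while c takes over the beginning of the
    subsequence of b. *)
Lemma knuth_acb s t a b c : a < b < c -> uniq (s ++ [:: a; c; b] ++ t) ->
  greene_equiv (s ++ [:: a; c; b] ++ t) (s ++ [:: c; a; b] ++ t).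
Proof.
move=> /andP[ab bc] u; split.
  by rewrite perm_cat2l perm_cat2r (perm_catCA [:: a] [:: c] [:: b]).
have [at_ ct bt] : [/\ a \notin t, c \notin t & b \notin t].
  move: u; rewrite cat_uniq /= !inE !negb_or.
  by case/and3P=> _ _ /and4P[/and3P[_ _ ->] /andP[_ ->] ->].
have [as_ bs cs st] :
    [/\ a \notin s, b \notin s, c \notin s & {in s, forall x, x \notin t}].
  move: u; rewrite cat_uniq => /and3P[_ /hasPn h _].
  split; try by apply: h; rewrite !inE eqxx ?orbT.
  by move=> x xs; apply/negP => xt; have := h x; rewrite mem_cat xt orbT xs => /(_ isT).
move=> k m; split=> -[col]; last first.
  move=> /chain_coloring_mid[h1 h2 h3 [h4 h5 h6]] <-; exists col.
    apply/chain_coloring_mid; split=> //; last by split=> // _ _; clear -ab bc; lia.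
      by move=> x /h2[].
    by move=> x /h3[].
  by rewrite !count_cat /=; clear; lia.
move=> /chain_coloring_mid[[hs ht hst] h2 h3 [h4 h5 h6]] <-.
rewrite /chain_rel in h2 h3 h4 h5 h6 hst.
have [/andP[/eqP e ck]|ne] := boolP ((col a == col c) && (col a < k)); last first.
  exists col; last by rewrite !count_cat /=; clear; lia.
  apply/chain_coloring_mid; rewrite /chain_rel; split=> //.
  - by move=> x /h2[].
  - by move=> x /h3[].
  - by split=> // ee; move: ne; rewrite ee eqxx => /negP.
have [bk|bk] := ltnP (col b) k; last first.
  (* The unused b takes the place of a or c in their common subsequence. *)
  pose col' x := if x == b then col a else if x == c then k else col x.
  have es x : x \in s -> col' x = col x.
    move=> xs; rewrite /col'.
    by do 2![case: eqP => [xx|_];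
      first by rewrite xx in xs; rewrite xs in cs bs].
  have et x : x \in t -> col' x = col x.
    move=> xs; rewrite /col'.
    by do 2![case: eqP => [xx|_];
      first by rewrite xx in xs; rewrite xs in ct bt].
  have ec : col' c = k by rewrite /col' eqxx; case: eqP => //; clear -bc; lia.
  have eb : col' b = col a by rewrite /col' eqxx.
  have ea : col' a = col a by rewrite /col'; do 2![case: eqP; first by clear -ab bc; lia].
  exists col'; last first.
    rewrite !count_cat /= ea eb ec.
    have -> : count (fun x => col' x < k) s = count (fun x => col x < k) s.
      by apply: eq_in_count; move=> x /es ->.
    have -> : count (fun x => col' x < k) t = count (fun x => col x < k) t.
      by apply: eq_in_count; move=> x /et ->.
    by move: bk ck; rewrite e; clear; lia.
  apply/chain_coloring_mid; rewrite /chain_rel ea eb ec; split; first split.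
  - by apply: chain_coloring_sub hs => x y /es-> /es->.
  - by apply: chain_coloring_sub ht => x y /et-> /et->.
  - by move=> x y xs yt; rewrite (es _ xs) (et _ yt); apply: hst.
  - by move=> x xs; rewrite (es _ xs); have [] := h2 x xs; split; chain_solve.
  - by move=> x xt; rewrite (et _ xt); have [] := h3 x xt; split; chain_solve.
  - by split; chain_solve.
(* P1 a c P2 and Q1 b Q2 exchange their tails, which keeps the same letters covered. *)
pose col' x :=
  if (x \in [:: b; c]) || (x \in t) then swap_col (col a) (col b) (col x) else col x.
have es x : x \in s -> col' x = col x.
  move=> xs; rewrite /col' (negbTE (st _ xs)) orbF !inE.
  by do 2![case: eqP => [xx|_]; first by rewrite xx in xs; rewrite xs in cs bs].
have et x : x \in t -> col' x = swap_col (col a) (col b) (col x).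
  by move=> xs; rewrite /col' xs orbT.
have ea : col' a = col a.
  by rewrite /col' (negbTE at_) !inE; do 2![case: eqP; first by clear -ab bc; lia].
have eb : col' b = col a.
  by rewrite /col' !inE eqxx /= /swap_col eqxx; case: eqP => // ->.
have ec : col' c = col b by rewrite /col' !inE eqxx orbT /swap_col e eqxx.
exists col'; last first.
  rewrite !count_cat /= ea eb ec.
  have -> : count (fun x => col' x < k) s = count (fun x => col x < k) s.
    by apply: eq_in_count; move=> x /es ->.
  have -> : count (fun x => col' x < k) t = count (fun x => col x < k) t.
    by apply: eq_in_count; move=> x /et ->; rewrite /swap_col; do 2?case: eqP; chain_solve.
  by rewrite -e ck bk; clear; lia.
apply/chain_coloring_mid; rewrite /chain_rel ea eb ec; split; first split.
- by apply: chain_coloring_sub hs => x y /es-> /es->.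
- apply: chain_coloring_sub ht => x y /et-> /et->.
  by rewrite /swap_col; do 4?case: eqP; chain_solve.
- move=> x y xs yt; rewrite (es _ xs) (et _ yt).
  have := hst x y xs yt; have [] := h2 x xs; have [] := h3 y yt.
  by rewrite /swap_col; do 2?case: eqP; chain_solve.
- by move=> x xs; rewrite (es _ xs); have [] := h2 x xs; split; chain_solve.
- move=> x xt; rewrite (et _ xt); have [] := h3 x xt.
  by rewrite /swap_col; do 2?case: eqP; split; chain_solve.
- by split; chain_solve.
Qed.

(** * Bumping in a single row as a chain of Knuth relations *)

Lemma uniq_greene_equiv u v : greene_equiv u v -> uniq u = uniq v.
Proof. by case=> /perm_uniq. Qed.

(** The letter x travels left through r. It passes each z by [knuth_bac], with the letter just
    before z in the middle role; that letter is y or another letter of r, hence above x and below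
    z. *)
Lemma greene_equiv_bump_right s t x y r :
  x < y -> path ltn y r -> uniq (s ++ y :: r ++ x :: t) ->
  greene_equiv (s ++ y :: r ++ x :: t) (s ++ y :: x :: r ++ t).
Proof.
elim: r s y => [|z r IHr] s y xy /=; first by move=> *; apply: greene_equiv_refl.
case/andP=> yz zr u.
have h : greene_equiv (s ++ y :: z :: r ++ x :: t) (s ++ y :: z :: x :: r ++ t).
  by rewrite -!(cat_rcons y) in u *; apply: IHr => //; apply: ltn_trans yz.
apply: (greene_equiv_trans h); rewrite (uniq_greene_equiv h) in u.
apply/greene_equiv_sym/(@knuth_bac s (r ++ t)); first by rewrite xy.
suff <- : uniq (s ++ [:: y; z; x] ++ r ++ t) = uniq (s ++ [:: y; x; z] ++ r ++ t) by [].
by apply/perm_uniq; rewrite perm_cat2l perm_cat2r /= perm_cons (perm_catC [:: z] [:: x]).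
Qed.

(** The letter y travels left through r. It passes each u by [knuth_acb], with the letter following
    u in the middle role; that letter is the next one of r, or x after the last one, hence above u
    and below y. *)
Lemma greene_equiv_bump_left s t x y r :
  x < y -> sorted ltn (rcons r x) -> uniq (s ++ r ++ y :: x :: t) ->
  greene_equiv (s ++ r ++ y :: x :: t) (s ++ y :: r ++ x :: t).
Proof.
move=> xy; elim: r s => [|u r IHr] s /=; first by move=> *; apply: greene_equiv_refl.
move=> ur un.
have h : greene_equiv (s ++ u :: r ++ y :: x :: t) (s ++ u :: y :: r ++ x :: t).
  by rewrite -!(cat_rcons u) in un *; apply: IHr => //; apply: path_sorted ur.
apply: (greene_equiv_trans h); rewrite (uniq_greene_equiv h) in un.
case: r ur un {IHr h} => [|v r] /=.
  rewrite andbT => ux un; apply: (@knuth_acb s t u x y) => //.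
  by rewrite ux.
case/andP=> uv; rewrite -[rcons _ _]/(behead (v :: rcons r x)) => vr un.
apply: (@knuth_acb s (r ++ x :: t) u v y) => //.
rewrite uv (ltn_trans _ xy) //.
by move: vr; rewrite /= (path_sortedE ltn_trans) all_rcons => /andP[/andP[]].
Qed.

(** One bumping step: x first moves left until it stands right behind y, then y moves to the front
    of the row. *)
Lemma greene_equiv_bump s t r1 r2 x y :
  x < y -> sorted ltn (rcons r1 x) -> path ltn y r2 ->
  uniq (s ++ (r1 ++ y :: r2) ++ x :: t) ->
  greene_equiv (s ++ (r1 ++ y :: r2) ++ x :: t) (s ++ y :: (r1 ++ x :: r2) ++ t).
Proof.
move=> xy r1x yr2 u.
have h : greene_equiv (s ++ (r1 ++ y :: r2) ++ x :: t)
                      (s ++ r1 ++ y :: x :: r2 ++ t).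
  rewrite -catA cat_cons in u *; rewrite !(catA s r1) in u *.
  exact: greene_equiv_bump_right.
apply: (greene_equiv_trans h); rewrite (uniq_greene_equiv h) in u.
by rewrite -catA cat_cons; apply: greene_equiv_bump_left.
Qed.

(** * Row insertion preserves the class of the reading word *)

(* [row_pos x r = size r] when nothing is bumped, and then [row_put] appends [x]. *)
Definition row_pos x r := find (fun y => x < y) r.
Definition row_put x r := set_nth 0 r (row_pos x r) x.

(** Rows are read from the bottom up, so a bumped letter comes to stand right behind the rows into
    which it is inserted next. *)
Fixpoint reading_word (t : seq (seq nat)) : seq nat :=
  if t is r :: t' then reading_word t' ++ r else [::].

Lemma row_insert_cons x r t :
  row_insert x (r :: t) =
  row_put x r :: (if row_pos x r < size r
                  then row_insert (nth 0 r (row_pos x r)) t else t).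
Proof.
rewrite /= /Defs.bump /row_put /row_pos; case: ltnP => // h; congr (_ :: _).
have -> : find [eta leq x.+1] r = size r by apply/eqP; rewrite eqn_leq h find_size.
by rewrite set_nthE ltnn subnn cats1.
Qed.

Lemma row_pos_before x r i : i < row_pos x r -> nth 0 r i <= x.
Proof. by move/(before_find 0)/negbT; rewrite -leqNgt. Qed.

Lemma row_pos_nth x r : row_pos x r < size r -> x < nth 0 r (row_pos x r).
Proof. by rewrite -has_find => /(nth_find 0). Qed.

Lemma take_row_pos x r : sorted ltn r -> x \notin r ->
  sorted ltn (rcons (take (row_pos x r) r) x).
Proof.
move=> sr xr; rewrite -cats1 (sorted_pairwise ltn_trans) pairwise_cat /= andbT.
rewrite -(sorted_pairwise ltn_trans) take_sorted // andbT.
apply/allrelP => y z /(nthP 0)[i]; rewrite size_take_min leq_min => /andP[ip isz].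
rewrite nth_take // inE => <- /eqP->; rewrite ltn_neqAle row_pos_before // andbT.
by apply: contraNneq xr => <-; apply: mem_nth.
Qed.

Lemma row_putE x r : row_pos x r < size r ->
  row_put x r = take (row_pos x r) r ++ x :: drop (row_pos x r).+1 r.
Proof. by rewrite /row_put set_nthE => ->. Qed.

Lemma row_put_rcons x r : size r <= row_pos x r -> row_put x r = rcons r x.
Proof.
move=> h; have e : row_pos x r = size r by apply/eqP; rewrite eqn_leq h find_size.
by rewrite /row_put e set_nthE ltnn subnn cats1.
Qed.

(** After one bump the letter y faces the lower rows as x faced the whole tableau. The suffix [s] is
    general because it absorbs the rows already finished. *)
Lemma greene_equiv_row_insert x t s : all (sorted ltn) t ->
  uniq (reading_word t ++ x :: s) ->
  greene_equiv (reading_word t ++ x :: s) (reading_word (row_insert x t) ++ s).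
Proof.
elim: t x s => [|r t IHt] x s; first by move=> *; apply: greene_equiv_refl.
case/andP=> sr st u; rewrite row_insert_cons; case: ltnP => h /=; last first.
  by rewrite row_put_rcons // -!catA cat_rcons; apply: greene_equiv_refl.
set y := nth _ _ _.
have xr : x \notin r.
  move: u; rewrite /= -catA !cat_uniq => /and3P[_ _ /and3P[_ /hasPn h' _]].
  by apply: h'; rewrite inE eqxx.
have dr : r = take (row_pos x r) r ++ y :: drop (row_pos x r).+1 r.
  by rewrite -drop_nth // cat_take_drop.
have e : greene_equiv (reading_word t ++ r ++ x :: s)
                      (reading_word t ++ y :: row_put x r ++ s).
  rewrite [in X in greene_equiv X]dr row_putE //; apply: greene_equiv_bump.
  - exact: row_pos_nth.
  - exact: take_row_pos.
  - by move: sr; rewrite {1}dr => /cat_sorted2[].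
  - by rewrite -dr catA.
rewrite -!catA; apply: (greene_equiv_trans e); apply: IHt => //.
by rewrite -(uniq_greene_equiv e) catA.
Qed.

(** * Insertion produces tableaux *)

(** Column-strictness for two rows, [r] lying over [r']. *)
Definition row_above r r' :=
  (size r' <= size r) && all (fun j => nth 0 r j < nth 0 r' j) (iota 0 (size r')).

Lemma row_aboveP r r' :
  reflect (size r' <= size r /\ forall j, j < size r' -> nth 0 r j < nth 0 r' j)
          (row_above r r').
Proof.
apply: (iffP andP) => -[le h]; split=> //.
  by move=> j js; apply: (allP h); rewrite mem_iota.
by apply/allP => j; rewrite mem_iota => /h.
Qed.

Lemma row_above_trans : transitive row_above.
Proof.
move=> b a c /row_aboveP[ba ab] /row_aboveP[cb bc]; apply/row_aboveP.
split=> [|j js]; first exact: leq_trans ba.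
exact: ltn_trans (ab j (leq_trans js cb)) (bc j js).
Qed.

Definition is_tableau (t : seq (seq nat)) := all (sorted ltn) t && sorted row_above t.

Lemma size_row_put x r : size (row_put x r) = maxn (row_pos x r).+1 (size r).
Proof. exact: size_set_nth. Qed.

Lemma row_put_sorted x r : sorted ltn r -> x \notin r -> sorted ltn (row_put x r).
Proof.
move=> sr xr; have := take_row_pos sr xr.
case: (ltnP (row_pos x r) (size r)) => h; last first.
  by rewrite row_put_rcons // take_oversize.
rewrite row_putE //; have dr := drop_nth 0 h.
have : sorted ltn (drop (row_pos x r) r) by apply: drop_sorted.
rewrite dr -cat_rcons; move: (row_pos_nth h) => /=.
case: (drop _.+1 r) => [|z s] /= xy; first by rewrite cats0.
case/andP=> yz zs tx; case: (take _ _) tx => [|u p] /=.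
  by rewrite (ltn_trans xy yz).
by rewrite cat_path => ->; rewrite last_rcons /= (ltn_trans xy yz).
Qed.

(** The bumped letter y never moves to the right, because any entry below its old place exceeds it.
    It thus lands under x or under an entry left of its old place, both smaller than y. In the other
    columns the upper entry can only decrease. *)
Lemma row_above_put x r r' : sorted ltn r -> row_above r r' ->
  row_pos x r < size r ->
  row_above (row_put x r) (row_put (nth 0 r (row_pos x r)) r').
Proof.
move=> sr /row_aboveP[le h] ps; set p := row_pos x r; set y := nth 0 r p.
have qp : row_pos y r' <= p.
  rewrite leqNgt; apply/negP => pq.
  have := row_pos_before pq; rewrite leqNgt h //.
  by apply: leq_trans pq _; apply: find_size.
apply/row_aboveP; rewrite !size_row_put; split.
  by rewrite geq_max !leq_max le orbT andbT ltnS qp.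
move=> j js; rewrite /row_put !nth_set_nth /= -/p.
have le_x : (if j == p then x else nth 0 r j) <= nth 0 r j.
  by case: eqP => // ->; apply/ltnW/row_pos_nth.
case: (eqVneq j (row_pos y r')) => [jq|jq]; last first.
  apply: leq_ltn_trans le_x (h _ _).
  by have : row_pos y r' <= size r' := find_size _ _; move: js jq; clear; lia.
case: (eqVneq j p) => jp; first exact: row_pos_nth.
by rewrite /y (sorted_ltn_nth ltn_trans) ?inE //; lia.
Qed.

(** The default [[::]] is harmless, since [row_above r [::]] always holds. *)
Lemma sorted_row_above_cons r t :
  sorted row_above (r :: t) = row_above r (head [::] t) && sorted row_above t.
Proof. by case: t. Qed.

Lemma head_row_insert x t : head [::] (row_insert x t) = row_put x (head [::] t).
Proof. by case: t => [|r t] //; rewrite row_insert_cons. Qed.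

Lemma is_tableau_insert x t : is_tableau t -> uniq (rcons (reading_word t) x) ->
  is_tableau (row_insert x t).
Proof.
elim: t x => [|r t IHt] x //.
rewrite /is_tableau sorted_row_above_cons /= => /andP[/andP[sr st] /andP[rt ct]] u.
have xr : x \notin r.
  by move: u; rewrite rcons_uniq mem_cat negb_or => /andP[/andP[]].
rewrite -/(row_insert x (r :: t)) row_insert_cons.
case: ltnP => h; rewrite sorted_row_above_cons /= row_put_sorted //=.
  have /andP[-> ->] : is_tableau (row_insert (nth 0 r (row_pos x r)) t).
    apply: IHt; first by apply/andP.
    move: u; rewrite !rcons_uniq !cat_uniq mem_cat => /and3P[_ -> /andP[/hasPn h' _]].
    by rewrite andbT; apply: h'; apply: mem_nth.
  by rewrite head_row_insert !andbT; apply: row_above_put.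
rewrite st ct andbT /=; apply/row_aboveP; have /row_aboveP[le lt] := rt.
rewrite row_put_rcons // size_rcons; split=> [|j js]; first exact: leqW.
by rewrite nth_rcons (leq_trans js le); apply: lt.
Qed.

(** The starting tableau is arbitrary so that the induction can follow a word whose prefix has
    already been inserted. *)
Lemma insertion_invariant t w : is_tableau t -> uniq (reading_word t ++ w) ->
  let t' := foldl (fun t x => row_insert x t) t w in
  is_tableau t' /\ greene_equiv (reading_word t ++ w) (reading_word t').
Proof.
elim: w t => [|x w IHw] t tt u /=.
  by rewrite cats0; split=> //; apply: greene_equiv_refl.
have e := greene_equiv_row_insert (proj1 (andP tt)) u.
have tx : is_tableau (row_insert x t).
  by apply: is_tableau_insert => //; move: u; rewrite -cat_rcons cat_uniq => /andP[].
rewrite (uniq_greene_equiv e) in u.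
by have [? e'] := IHw _ tx u; split=> //; apply: greene_equiv_trans e e'.
Qed.

Lemma insertion_tableauP w : uniq w ->
  is_tableau (insertion_tableau w) /\
  greene_equiv w (reading_word (insertion_tableau w)).
Proof. exact: (@insertion_invariant [::]). Qed.

(** * Greene's theorem for the reading word of a tableau *)

(** The first k rows are themselves k disjoint increasing subsequences: each letter gets the index
    of its row as colour, built up by shifting the colours of the lower rows. *)
Lemma tableau_chain_coloring k t :
  all (sorted ltn) t -> uniq (reading_word t) ->
  exists2 c, chain_coloring k c (reading_word t)
           & count (fun x => c x < k) (reading_word t)
             = \sum_(i < k) nth 0 (map size t) i.
Proof.
elim: t k => [|r t IHt] k.
  by exists id => //=; rewrite big1 // => i _; rewrite nth_nil.
case: k => [|k] /=.
  move=> _ _; exists id; last by rewrite big_ord0 count_pred0.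
  by apply/(pairwiseP 0) => i j * /=; rewrite ltn0 andbF.
case/andP=> sr st; rewrite cat_uniq => /and3P[ut /hasPn tr ur].
have [c hc ec] := IHt k st ut.
pose c' x := if x \in r then 0 else (c x).+1.
have c'r x : x \in r -> c' x = 0 by rewrite /c' => ->.
have c't x : x \in reading_word t -> c' x = (c x).+1.
  by move=> xt; rewrite /c'; case: ifP => // /tr; rewrite /= xt.
exists c'.
  rewrite chain_coloring_cat; apply/and3P; split.
  - by apply/allrelP => x y /c't -> /c'r ->.
  - apply: chain_coloring_sub hc => x y /c't -> /c't -> [->].
    by rewrite ltnS.
  - move: sr; rewrite (sorted_pairwise ltn_trans); apply: sub_pairwise => x y xy.
    by rewrite xy implybT.
rewrite count_cat big_ord_recl /= addnC; congr (_ + _).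
  by rewrite -size_filter (eq_in_filter (a2 := predT)) ?filter_predT // => x /c'r ->.
by rewrite -ec; apply: eq_in_count => x /c't ->.
Qed.

(** The reading word meets a column from the bottom up, in decreasing order, so an increasing
    subsequence takes at most one of its entries. *)
Lemma column_colors_uniq k c t j :
  is_tableau t -> chain_coloring k c (reading_word t) ->
  uniq [seq c (nth 0 r j) | r <- t & (j < size r) && (c (nth 0 r j) < k)].
Proof.
elim: t => [|r t IHt] //; rewrite /is_tableau /=.
case/andP=> /andP[sr st] /[dup] /path_sorted pt.
rewrite (path_sortedE row_above_trans) => /andP[/allP rt _].
rewrite chain_coloring_cat => /and3P[/allrel_chainP crt ct _].
have ut := IHt (introT andP (conj st pt)) ct.
case: ifP => //= /andP[jr cj]; rewrite ut andbT.
apply/negP => /mapP[r']; rewrite mem_filter => /andP[/andP[jr' cj'] r't] e.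
have /row_aboveP[_ /(_ j jr')] := rt _ r't.
apply/negP; rewrite -leqNgt ltnW //; apply: crt; rewrite ?mem_nth //.
elim: (t) r't => //= r0 t0 IH; rewrite inE mem_cat => /orP[/eqP <-|/IH ->] //.
by rewrite mem_nth ?orbT.
Qed.

Lemma count_sum (T : Type) (a : pred T) s : count a s = \sum_(x <- s) a x.
Proof. by elim: s => [|x s IH] /=; rewrite ?big_nil // big_cons IH. Qed.

Lemma sum_ltn_ord n m : \sum_(j < m) (j < n) = minn n m.
Proof. by elim: m => [|m IH]; rewrite ?big_ord0 ?big_ord_recr ?IH /=; lia. Qed.

Lemma sum_reading_word (f : nat -> nat) t :
  \sum_(x <- reading_word t) f x = \sum_(r <- t) \sum_(x <- r) f x.
Proof.
elim: t => [|r t IHt] /=; first by rewrite !big_nil.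
by rewrite big_cat big_cons IHt addnC.
Qed.

(** Such a [b] marks an initial segment. Either it holds at the last index of the prefix, and the
    whole prefix counts, or it fails there, and nothing beyond contributes. *)
Lemma sum_prefix_nonincreasing (b : nat -> bool) k m :
  (forall i j, i <= j -> b j -> b i) ->
  minn k (\sum_(i < m) b i) <= \sum_(i < k) b i.
Proof.
move=> mono; case: k => [|k]; first by rewrite min0n.
have [bk|bk] := boolP (b k).
  apply: leq_trans (geq_minl _ _) _.
  rewrite -[leqLHS](card_ord k.+1) -sum1_card; apply: leq_sum => i _.
  by rewrite (mono i k) // -ltnS.
apply: leq_trans (geq_minr _ _) _.
apply: (@leq_trans (\sum_(i < k.+1 + m) b i)).
  by rewrite addnC big_split_ord /= leq_addr.
rewrite big_split_ord /= [X in _ + X]big1 ?addn0 // => i _.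
by apply/eqP; rewrite eqb0; apply: contra bk; apply: mono; rewrite addSn leqW ?leq_addr.
Qed.

Lemma shape_nonincreasing t i j :
  is_tableau t -> i <= j -> nth 0 (map size t) j <= nth 0 (map size t) i.
Proof.
move=> /andP[_ st] ij; have [jt|jt] := ltnP j (size t); last first.
  by rewrite nth_default // size_map.
have it := leq_ltn_trans ij jt; rewrite !(nth_map [::]) //.
move: ij; rewrite leq_eqVlt => /orP[/eqP -> //|ij].
by have /row_aboveP[] := sorted_ltn_nth row_above_trans [::] st i j it jt ij.
Qed.

(** Count by columns: a column of height h has at most min(k, h) covered letters, and exactly min(k,
    h) of its cells lie in the first k rows. *)
Lemma tableau_covers_le k c t :
  is_tableau t -> chain_coloring k c (reading_word t) ->
  count (fun x => c x < k) (reading_word t) <= \sum_(i < k) nth 0 (map size t) i.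
Proof.
move=> tt hc; pose M := \max_(r <- t) size r.
(* [M] bounds all row lengths, so both sides can be written as sums over the same [M] columns. *)
have sM r : r \in t -> size r <= M by move=> rt; apply: leq_bigmax_seq.
have -> : \sum_(i < k) nth 0 (map size t) i =
          \sum_(j < M) \sum_(i < k) (j < nth 0 (map size t) i).
  rewrite exchange_big; apply: eq_bigr => i _ /=; rewrite sum_ltn_ord.
  apply/esym/minn_idPl; have [it|it] := ltnP i (size t); last by rewrite nth_default ?size_map.
  by rewrite (nth_map [::]) //; apply/sM/mem_nth.
rewrite count_sum sum_reading_word.
have -> : \sum_(r <- t) \sum_(x <- r) (c x < k) =
          \sum_(j < M) \sum_(r <- t) ((j < size r) && (c (nth 0 r j) < k)).
  rewrite exchange_big /= big_seq [RHS]big_seq; apply: eq_bigr => r rt.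
  rewrite (big_nth 0) big_mkord (big_ord_widen _ (fun j => (c (nth 0 r j) < k) : nat) (sM r rt)).
  by rewrite big_mkcond; apply: eq_bigr => j _; case: ifP.
apply: leq_sum => j _.
pose b i := j < nth 0 (map size t) i.
apply: leq_trans (@sum_prefix_nonincreasing b k (size t) _); last first.
  by move=> i i' ii /leq_trans; apply; apply: shape_nonincreasing.
(* The bound k comes from the distinct colours in column j, the other bound from its height. *)
rewrite -(count_sum (fun r => (j < size r) && (c (nth 0 r j) < k))) leq_min.
apply/andP; split.
  have := column_colors_uniq j tt hc; rewrite -size_filter.
  set s := filter _ _ => /(@uniq_leq_size _ _ (iota 0 k)).
  rewrite size_map size_iota; apply=> x /mapP[r].
  by rewrite mem_filter mem_iota => /andP[/andP[_ ck] _] ->.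
rewrite -(big_mkord xpredT (fun i => (j < nth 0 (map size t) i) : nat)).
rewrite -[X in \sum_(0 <= i < X) _](size_map size) -(big_nth 0 xpredT (fun x => (j < x) : nat)).
by rewrite big_map -count_sum; apply: sub_count => r /andP[].
Qed.

(** * Greene's theorem for words with distinct letters *)

Definition insertion_shape w := map size (insertion_tableau w).

(** The attainment half of Greene's theorem, carried over from the reading word; [greene_max] is the
    optimality half. *)
Lemma greene_covers w k : uniq w -> covers k w (\sum_(i < k) nth 0 (insertion_shape w) i).
Proof.
move=> uw; have [tt [pw gw]] := insertion_tableauP uw; apply/gw.
have [|c hc <-] := tableau_chain_coloring k (proj1 (andP tt)); last by exists c.
by rewrite -(perm_uniq pw).
Qed.

Lemma greene_max w k m : uniq w -> covers k w m ->
  m <= \sum_(i < k) nth 0 (insertion_shape w) i.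
Proof.
move=> uw; have [tt [pw gw]] := insertion_tableauP uw => /gw[c hc <-].
exact: tableau_covers_le.
Qed.

Lemma insertion_shape_nonincreasing w i j : uniq w -> i <= j ->
  nth 0 (insertion_shape w) j <= nth 0 (insertion_shape w) i.
Proof. by move=> /insertion_tableauP[tt _]; apply: shape_nonincreasing. Qed.

(** By [greene_covers], the left side counts the letters of [w] covered by some colouring. *)
Lemma insertion_shape_sum w k : uniq w ->
  \sum_(i < k) nth 0 (insertion_shape w) i <= size w.
Proof. by move=> /(@greene_covers w k)[c _ <-]; apply: count_size. Qed.

(** * The numerical inequality for interlacing partial sums *)

(* The two sequences exchange roles in the induction each time their first terms differ. *)
Lemma sum_alternating n f g :
  {homo f : i j /~ i <= j} -> {homo g : i j /~ i <= j} ->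
  (forall i, i <= n -> \sum_(j < i) g j <= \sum_(j < i) f j <= (\sum_(j < i) g j).+1) ->
  let l := \sum_(i < n) natdist (f i) (g i) in
  [/\ l <= f 0, l <= (g 0).+1 & l * l <= \sum_(i < n) f i + \sum_(i < n) g i].
Proof.
elim: n f g => [|n IHn] f g hf hg h /=.
  by rewrite !big_ord0.
have recl (k : nat -> nat) i : \sum_(j < i.+1) k j = k 0 + \sum_(j < i) k j.+1.
  by rewrite big_ord_recl.
have f01 : f 1 <= f 0 by apply: hf.
have g01 : g 1 <= g 0 by apply: hg.
have hf' : {homo (fun i => f i.+1) : i j /~ i <= j} by move=> i j ij; apply: hf.
have hg' : {homo (fun i => g i.+1) : i j /~ i <= j} by move=> i j ij; apply: hg.
have h1 : g 0 <= f 0 <= (g 0).+1 by have := h 1 isT; rewrite !big_ord1.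
rewrite (recl (fun i => natdist (f i) (g i))) !recl.
have [e|ne] := eqVneq (f 0) (g 0).
  have [i le_in|] := IHn _ _ hf' hg'.
    by move: (h i.+1 le_in); rewrite !recl e; clear; lia.
  set l := \sum_(i < n) _; move: f01 g01; rewrite e /natdist subnn.
  by move: l (\sum_(i < n) _) (\sum_(i < n) _) => l F G; clear => *; split; lia.
(* The lead of [f] is used up at once, so in the tails [g] is ahead. If l is the distance of the
   tails, then l <= g 1 <= g 0, so passing from l to l + 1 raises the square by 2 l + 1 <= 2 (g 0) +
   1 = f 0 + g 0. *)
have e : f 0 = (g 0).+1 by move: h1 ne; clear; lia.
have [i le_in|] := IHn _ _ hg' hf'.
  by move: (h i.+1 le_in); rewrite !recl e; clear; lia.
under eq_bigr do rewrite /natdist addnC -/(natdist _ _).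
set l := \sum_(i < n) _; move: f01 g01; rewrite e /natdist.
have -> : (g 0).+1 - g 0 + (g 0 - (g 0).+1) = 1 by clear; lia.
by move: l (\sum_(i < n) _) (\sum_(i < n) _) => l F G; clear => *; split; lia.
Qed.

(** * Exchanging the values x and x+1 in a word *)

(** The negative form also covers words lacking one of the letters, and as a [pairwise] condition it
    can be intersected with [chain_coloring]. *)
Definition appears_before (x y : nat) (w : seq nat) :=
  pairwise (fun a b => ~~ ((a == y) && (b == x))) w.

(** Whichever of the two letters comes first decides, since it does not occur again. *)
Lemma appears_before_total x y w : uniq w -> x != y ->
  appears_before x y w \/ appears_before y x w.
Proof.
move=> uw ne; rewrite /appears_before; elim: w uw => [|z w IHw] /=; first by left.
case/andP=> zw uw; have [ex|zx] := eqVneq z x.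
  left; rewrite (negbTE (_ : z != y)) ?ex //= all_predT.
  apply/(pairwiseP 0) => i j ilt jlt _; apply/nandP; right.
  by apply: contraNneq zw => e; rewrite ex -e; apply: mem_nth.
have [ey|zy] := eqVneq z y.
  right; rewrite all_predT.
  apply/(pairwiseP 0) => i j ilt jlt _; apply/nandP; right.
  by apply: contraNneq zw => e; rewrite ey -e; apply: mem_nth.
by rewrite /= !all_predT; apply: IHw.
Qed.

Definition swap_val (x y z : nat) := if z == x then y else if z == y then x else z.

Lemma swap_valK x y : involutive (swap_val x y).
Proof. by move=> z; rewrite /swap_val; do 4?case: eqP => //; congruence. Qed.

Lemma swap_val_eql x y z : (swap_val x y z == x) = (z == y).
Proof.
rewrite -[RHS](inj_eq (can_inj (swap_valK x y))); congr (_ == _).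
by rewrite /swap_val eqxx; case: eqVneq.
Qed.

Lemma swap_val_eqr x y z : (swap_val x y z == y) = (z == x).
Proof. by rewrite -[RHS](inj_eq (can_inj (swap_valK x y))) {3}/swap_val eqxx. Qed.

Lemma appears_before_swap x y w :
  appears_before x y (map (swap_val x y) w) = appears_before y x w.
Proof.
rewrite /appears_before pairwise_map; apply: eq_pairwise => a b /=.
by rewrite swap_val_eql swap_val_eqr.
Qed.

(** Keep the colours of the positions. The exchange alters the order of no pair of values but x,
    x+1, and in [w] that pair is increasing. *)
Lemma covers_swap_le x w k m : appears_before x x.+1 w ->
  covers k (map (swap_val x x.+1) w) m -> covers k w m.
Proof.
move=> xw [c hc <-]; exists (c \o swap_val x x.+1); last by rewrite count_map.
move: hc; rewrite /chain_coloring pairwise_map => hc.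
have := introT andP (conj hc xw); rewrite -pairwise_relI.
apply: sub_pairwise => a b /= /andP[/implyP h ne]; apply/implyP => /h; move: ne.
by rewrite /swap_val; do 4?case: eqP => //=; clear; lia.
Qed.

(** Only the pair x, x+1 can cease to increase, so leaving one of its letters uncoloured repairs the
    colouring. *)
Lemma covers_swap_ge x w k m : uniq w -> covers k w m ->
  exists2 m', m <= m'.+1 & covers k (map (swap_val x x.+1) w) m'.
Proof.
set s := swap_val x x.+1 => uw [c hc <-].
(* Colours follow the positions, and the letter x of the new word is dropped. *)
pose c' z := if z == x then k else c (s z).
have ec' a : c' (s a) = if a == x.+1 then k else c a.
  by rewrite /c' /s swap_val_eql swap_valK.
exists (count (fun z => c' z < k) (map s w)); last first.
  exists c' => //; rewrite /chain_coloring pairwise_map.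
  apply: sub_pairwise hc => a b /= /implyP h; apply/implyP => /andP[/eqP].
  rewrite !ec'; case: (eqVneq a x.+1) => [_|ax]; first by rewrite ltnn.
  case: (eqVneq b x.+1) => [_ ->|bx e ck]; first by rewrite ltnn.
  have {}h : a < b by apply: h; rewrite e eqxx -e.
  by move: h ax bx; rewrite /s /swap_val; do 4?case: eqP; clear; lia.
rewrite count_map.
(* A covered letter of [w] stays covered unless it is x+1, which occurs at most once. *)
have h : count_mem x.+1 w <= 1 by rewrite count_uniq_mem // leq_b1.
rewrite -add1n; apply: leq_trans (leq_add h (leqnn _)).
rewrite -count_predUI; apply: leq_trans (leq_addr _ _).
by apply: sub_count => a /= ck; rewrite ec'; case: eqP.
Qed.

Lemma shape_l1_swap_before x w : uniq w -> appears_before x x.+1 w ->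
  let l := shape_l1 (size w) (insertion_shape w)
                             (insertion_shape (map (swap_val x x.+1) w)) in
  l * l <= size w + size w.
Proof.
move=> uw xw; set w' := map _ w.
have uw' : uniq w' by rewrite map_inj_uniq //; apply: can_inj (swap_valK _ _).
have [||k _|_ _] := @sum_alternating (size w) (nth 0 (insertion_shape w))
                            (nth 0 (insertion_shape w')).
- by move=> i j; apply: insertion_shape_nonincreasing.
- by move=> i j; apply: insertion_shape_nonincreasing.
- apply/andP; split.
    exact/(greene_max uw)/(covers_swap_le xw)/greene_covers.
  have [m le hm] := covers_swap_ge x uw (greene_covers k uw).
  by apply: leq_trans le _; rewrite ltnS; apply: greene_max hm.
move=> h; apply: leq_trans h _; apply: leq_add; first exact: insertion_shape_sum.
by rewrite -[leqRHS](size_map (swap_val x x.+1)); apply: insertion_shape_sum.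
Qed.

Lemma shape_l1C n la mu : shape_l1 n la mu = shape_l1 n mu la.
Proof. by apply: eq_bigr => i _; rewrite /natdist addnC. Qed.

(** If x+1 comes first, then x comes first in the swapped word. The exchange is an involution and
    the distance is symmetric, so the previous case applies to that word. *)
Lemma shape_l1_swap x w : uniq w ->
  let l := shape_l1 (size w) (insertion_shape w)
                             (insertion_shape (map (swap_val x x.+1) w)) in
  l * l <= size w + size w.
Proof.
move=> uw; have ne : x != x.+1 by rewrite -[X in X != _]addn0 -addn1 eqn_add2l.
case: (appears_before_total uw ne) => xw; first exact: shape_l1_swap_before.
have uw' : uniq (map (swap_val x x.+1) w).
  by rewrite map_inj_uniq //; apply: can_inj (swap_valK _ _).
rewrite -appears_before_swap in xw; have := shape_l1_swap_before uw' xw.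
by rewrite mapK ?size_map 1?shape_l1C //; apply: swap_valK.
Qed.

(** * Permutations and the final bound *)

Lemma one_line_adj_lmul n (k : 'I_n) (pi : 'S_n) : k.+1 < n ->
  one_line (adj_lmul k pi) = map (swap_val k k.+1) (one_line pi).
Proof.
move=> kn; rewrite /one_line -map_comp; apply: eq_map => i /=.
(* Since k+1 < n, [insubd] does not fall back on its default k. *)
set j := insubd k k.+1; have vk : val j = k.+1 by rewrite val_insubd kn.
rewrite /adj_lmul -/j permM permE /= -vk /swap_val !val_eqE.
by case: ifP => // _; case: ifP.
Qed.

Lemma size_one_line n (pi : 'S_n) : size (one_line pi) = n.
Proof. by rewrite size_map size_enum_ord. Qed.

Lemma one_line_uniq n (pi : 'S_n) : uniq (one_line pi).
Proof.
by rewrite map_inj_uniq ?enum_uniq // => i j /val_inj/perm_inj.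
Qed.

Import Order.TTheory GRing.Theory Num.Theory.
Local Open Scope ring_scope.

Theorem theorem2 (R : rcfType) (n : nat) (pi tau : 'S_n) :
  perm_dist_is 1 pi tau ->
  Delta R n (rsk_shape pi) (rsk_shape tau) <= Num.sqrt (n%:R / 2%:R : R).
Proof.
case=> -[ks [sz ks_lt ->]] _.
case: ks sz ks_lt => [|k [|//]] //= _; rewrite andbT => kn.
have := shape_l1_swap k (one_line_uniq pi).
rewrite -one_line_adj_lmul // size_one_line -/(rsk_shape _) -/(rsk_shape _) /Delta.
set l := shape_l1 _ _ _ => /= ll.
(* Both sides are nonnegative, so it suffices to compare squares: (l/2)^2 <= n/2 amounts to l^2 <=
   2n. *)
rewrite -(@ler_pXn2r _ 2) ?nnegrE ?sqrtr_ge0 ?divr_ge0 ?ler0n //.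
rewrite sqr_sqrtr ?divr_ge0 ?ler0n //.
have : (l%:R * l%:R <= n%:R + n%:R :> R) by rewrite -natrM -natrD ler_nat.
by lra.
Qed.
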